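(* Let $A$ be an integral domain with quotient field $K$ and let $M$ be a PS module over $A$. Then: (i) $Kx\cap M$ is a locally cyclic PS module over $A$ for each $x\in M$. (ii) Every rank one PS module over $A$ is locally cyclic, hence flat. (iii) $A$ is a PS domain provided it has a finitely generated rank one PS module.
   Context: All rings are commutative and unitary. Let $A$ be an integral domain with quotient field $K$. A torsion-free $A$-module $M$ is a PS module (pre-Schreier module) if every equality $ax=by$ with $a,b\in A-\{0\}$ and $x,y\in M-\{0\}$ has a refinement, i.e. there exist $c,d,e\in A$ and $z\in M$ with $a=ce$, $b=cd$, $x=dz$, $y=ez$. $A$ is a PS domain (pre-Schreier domain) if it is a PS module over itself. A torsion-free $A$-module $M$ is viewed inside $K\otimes_A M$, and $Kx\cap M$ is formed there; the rank of $M$ is $\dim_K(K\otimes_A M)$. An $A$-module is locally cyclic if each of its finitely generated submodules is contained in a cyclic submodule (of it). *)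

(* Defs.v *)
From HB Require Import structures.
From mathcomp Require Import all_boot all_order all_algebra.
From mathcomp Require Import boolp.
From mathcomp Require Import finmap.
From mathcomp.multinomials Require Import monalg.

Set Implicit Arguments.
Unset Strict Implicit.
Unset Printing Implicit Defensive.

Import GRing.Theory.
Local Open Scope ring_scope.
Local Open Scope quotient_scope.

Section LinearSpan.
Variables (A : nzRingType) (V : lmodType A).

Definition lspan (S : V -> Prop) (v : V) : Prop :=
  exists2 s : seq (A * V), (forall p, p \in s -> S p.2)
    & v = \sum_(p <- s) p.1 *: p.2.

Definition lspanb (S : V -> Prop) : {pred V} := fun v => `[< lspan S v >].

Lemma lspanb_submod_closed S : submod_closed (lspanb S).
Proof.
split=> [|a u v /asboolP[s Ss ->] /asboolP[t St ->]]; apply/asboolP.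
  by exists [::]; rewrite ?big_nil.
exists ([seq (a * p.1, p.2) | p <- s] ++ t) => [p|].
  by rewrite mem_cat => /orP[/mapP[q /Ss Sq ->]|/St].
rewrite big_cat big_map scaler_sumr /=; congr (_ + _).
by apply: eq_bigr => p _; rewrite scalerA.
Qed.

HB.instance Definition _ S :=
  GRing.isSubmodClosed.Build A V (lspanb S)
    (GRing.submod_closed_semi (lspanb_submod_closed S)).

Lemma mem_lspanb (S : V -> Prop) v : S v -> v \in lspanb S.
Proof.
move=> Sv; apply/asboolP; exists [:: (1, v)] => [p|].
  by rewrite inE => /eqP ->.
by rewrite big_seq1 scale1r.
Qed.

End LinearSpan.

Section QuotientModule.
Variables (A : nzRingType) (V : lmodType A) (S : V -> Prop).

Definition quotmod := Quotient.quot (lspanb S).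

HB.instance Definition _ := GRing.Zmodule.on quotmod.
Definition qclass (v : V) : quotmod := \pi_(Quotient.quot (lspanb S)) v.

Lemma qclassP u v : qclass u = qclass v <-> u - v \in lspanb S.
Proof. by rewrite Quotient.idealrBE; split=> /eqP. Qed.

Lemma qclassD : {morph qclass : u v / u + v}.
Proof. by move=> u v; rewrite /qclass raddfD. Qed.

Lemma qclass_surj (q : quotmod) : exists v, q = qclass v.
Proof. by exists (repr q); rewrite /qclass reprK. Qed.

Definition qscale (a : A) (q : quotmod) : quotmod :=
  qclass (a *: repr (q : Quotient.quot (lspanb S))).

Lemma qscaleE a v : qscale a (qclass v) = qclass (a *: v).
Proof.
apply/qclassP; rewrite -scalerBr; apply: rpredZ; apply/qclassP.
by rewrite /qclass reprK.
Qed.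

Lemma qscaleA a b q : qscale a (qscale b q) = qscale (a * b) q.
Proof. by have [v ->] := qclass_surj q; rewrite !qscaleE scalerA. Qed.

Lemma qscale1 : left_id 1 qscale.
Proof. by move=> q; have [v ->] := qclass_surj q; rewrite qscaleE scale1r. Qed.

Lemma qscaleDr : right_distributive qscale +%R.
Proof.
move=> a q r; have [u ->] := qclass_surj q; have [v ->] := qclass_surj r.
by rewrite -qclassD !qscaleE scalerDr qclassD.
Qed.

Lemma qscaleDl q : {morph qscale^~ q : a b / a + b}.
Proof.
move=> a b; have [v ->] := qclass_surj q.
by rewrite !qscaleE scalerDl qclassD.
Qed.

HB.instance Definition _ :=
  GRing.Zmodule_isLmodule.Build A quotmod qscaleA qscale1 qscaleDr qscaleDl.

Lemma qclass_linear : linear qclass.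
Proof. by move=> a u v; rewrite qclassD -qscaleE. Qed.

HB.instance Definition _ :=
  GRing.isLinear.Build A V quotmod *:%R qclass qclass_linear.

End QuotientModule.

(* M (x)_A N is the free A-module on M * N modulo the bilinearity relations. *)
Section Tensor.
Variables (A : comNzRingType) (M N : lmodType A).

Local Notation F := {malg A[(M * N)%type]}.
Local Notation gen m n := (<< ((m, n) : (M * N)%type) >> : F).

Variant tensor_rel : F -> Prop :=
| tensor_relDl m m' n : tensor_rel (gen (m + m') n - (gen m n + gen m' n))
| tensor_relDr m n n' : tensor_rel (gen m (n + n') - (gen m n + gen m n'))
| tensor_relZl a m n : tensor_rel (gen (a *: m) n - a *: gen m n)
| tensor_relZr a m n : tensor_rel (gen m (a *: n) - a *: gen m n).

Definition tensor := quotmod tensor_rel.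
HB.instance Definition _ := GRing.Lmodule.on tensor.

Definition tensor_pi : F -> tensor := @qclass _ _ tensor_rel.
HB.instance Definition _ := GRing.Linear.on tensor_pi.

Definition tens (m : M) (n : N) : tensor := tensor_pi (gen m n).

Lemma tensor_pi_rel g h : tensor_rel (g - h) -> tensor_pi g = tensor_pi h.
Proof. by move=> r; apply/qclassP/mem_lspanb. Qed.

Lemma tensDl m m' n : tens (m + m') n = tens m n + tens m' n.
Proof. by rewrite -raddfD; apply: tensor_pi_rel; exact: tensor_relDl. Qed.

Lemma tensDr m n n' : tens m (n + n') = tens m n + tens m n'.
Proof. by rewrite -raddfD; apply: tensor_pi_rel; exact: tensor_relDr. Qed.

Lemma tensZl a m n : tens (a *: m) n = a *: tens m n.
Proof. by rewrite -linearZ; apply: tensor_pi_rel; exact: tensor_relZl. Qed.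

Lemma tensZr a m n : tens m (a *: n) = a *: tens m n.
Proof. by rewrite -linearZ; apply: tensor_pi_rel; exact: tensor_relZr. Qed.

Lemma tensor_piE g : tensor_pi g = \sum_(k <- msupp g) g@_k *: tens k.1 k.2.
Proof.
rewrite {1}[g]monalgE raddf_sum; apply: eq_bigr => -[m n] _ /=.
rewrite -linearZ /=; congr tensor_pi; apply/malgP => k.
by rewrite mcoeffZ !mcoeffU mulr_natr.
Qed.

Lemma tensor_ind (P : tensor -> Prop) :
    P 0 -> (forall a m n t, P t -> P (a *: tens m n + t)) -> forall t, P t.
Proof.
move=> P0 PS t; have [g ->] := qclass_surj t.
rewrite -[qclass _ g]/(tensor_pi g) tensor_piE.
by elim: (enum_fset _) => [|k s IH]; rewrite ?big_nil // big_cons; apply: PS.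
Qed.

Section Lift.
Variables (P : lmodType A) (b : M -> N -> P).
Hypothesis bDl : forall m m' n, b (m + m') n = b m n + b m' n.
Hypothesis bDr : forall m n n', b m (n + n') = b m n + b m n'.
Hypothesis bZl : forall a m n, b (a *: m) n = a *: b m n.
Hypothesis bZr : forall a m n, b m (a *: n) = a *: b m n.
Definition free_lift (g : F) : P := \sum_(k <- msupp g) g@_k *: b k.1 k.2.

Lemma free_liftEw (d : {fset (M * N)%type}) g : (msupp g `<=` d)%fset ->
  free_lift g = \sum_(k <- d) g@_k *: b k.1 k.2.
Proof.
move=> le; rewrite /free_lift (big_fset_incl _ le) // => k _.
by move/mcoeff_outdom ->; rewrite scale0r.
Qed.

Lemma free_lift_linear : linear free_lift.
Proof.
move=> a g h; pose d := (msupp g `|` msupp h)%fset.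
have hd : (msupp h `<=` d)%fset by apply: fsubsetUr.
have gd : (msupp g `<=` d)%fset by apply: fsubsetUl.
have sd : (msupp (a *: g + h) `<=` d)%fset.
  apply: fsubset_trans (msuppD_le _ _) _; apply: fsetSU; exact: msuppZ_le.
rewrite (free_liftEw sd) (free_liftEw hd) (free_liftEw gd).
rewrite scaler_sumr -big_split /=; apply: eq_bigr => k _.
by rewrite mcoeffD mcoeffZ scalerDl scalerA.
Qed.

HB.instance Definition _ :=
  GRing.isLinear.Build A F P *:%R free_lift free_lift_linear.

Lemma free_lift_gen m n : free_lift (gen m n) = b m n.
Proof. by rewrite /free_lift msuppU oner_eq0 big_seq_fset1 mcoeffUU scale1r. Qed.

Lemma free_lift_rel g : tensor_rel g -> free_lift g = 0.
Proof.
case=> *; apply/eqP; rewrite linearB subr_eq0; apply/eqP;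
  rewrite ?[RHS]linearD ?[RHS]linearZ /= !free_lift_gen.
- exact: bDl.
- exact: bDr.
- exact: bZl.
- exact: bZr.
Qed.

Definition tensor_lift (t : tensor) : P :=
  free_lift (repr (t : Quotient.quot (lspanb tensor_rel))).

Lemma tensor_lift_pi g : tensor_lift (tensor_pi g) = free_lift g.
Proof.
apply/eqP; rewrite -subr_eq0 -linearB /=; apply/eqP.
have : repr (tensor_pi g : Quotient.quot (lspanb tensor_rel)) - g
    \in lspanb tensor_rel by apply/qclassP; rewrite /qclass reprK.
move=> /asboolP[s rs ->]; rewrite linear_sum big_seq big1 // => p /rs rp.
by rewrite linearZ /= free_lift_rel ?scaler0.
Qed.

Lemma tensor_lift_linear : linear tensor_lift.
Proof.
move=> a t u; have [g ->] := qclass_surj t; have [h ->] := qclass_surj u.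
rewrite -![qclass _ _]/(tensor_pi _) -linearP !tensor_lift_pi.
exact: free_lift_linear.
Qed.

Lemma tensor_liftE m n : tensor_lift (tens m n) = b m n.
Proof. by rewrite tensor_lift_pi free_lift_gen. Qed.

End Lift.
End Tensor.

Section TensorMap.
Variables (A : comNzRingType) (M M' N N' : lmodType A).
Variables (f : {linear M -> M'}) (g : {linear N -> N'}).

Definition tensor_map : tensor M N -> tensor M' N' :=
  tensor_lift (fun m n => tens (f m) (g n)).

Lemma tensor_map_linear : linear tensor_map.
Proof.
by apply: tensor_lift_linear => *;
  rewrite ?linearD ?linearZ ?tensDl ?tensDr ?tensZl ?tensZr.
Qed.

HB.instance Definition _ :=
  GRing.isLinear.Build A (tensor M N) (tensor M' N') *:%R tensor_map
    tensor_map_linear.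

Lemma tensor_mapE m n : tensor_map (tens m n) = tens (f m) (g n).
Proof.
by apply: tensor_liftE => *;
  rewrite ?linearD ?linearZ ?tensDl ?tensDr ?tensZl ?tensZr.
Qed.

End TensorMap.

Definition flat (A : comNzRingType) (M : lmodType A) : Prop :=
  forall (N P : lmodType A) (f : {linear N -> P}),
    injective f -> injective (tensor_map (@idfun M) f).

(* The quotient field of A, with its A-module structure. *)
Section FractionModule.
Variable A : idomainType.
Local Notation K := {fraction A}.

Definition fracmod := K.
HB.instance Definition _ := GRing.Zmodule.on fracmod.

Definition frac_scale (a : A) (k : fracmod) : fracmod := (tofrac a * k : K).

Lemma frac_scaleA a b k : frac_scale a (frac_scale b k) = frac_scale (a * b) k.
Proof. by rewrite /frac_scale rmorphM mulrA. Qed.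
Lemma frac_scale1 : left_id 1 frac_scale.
Proof. by move=> k; rewrite /frac_scale rmorph1 mul1r. Qed.
Lemma frac_scaleDr : right_distributive frac_scale +%R.
Proof. by move=> a k l; rewrite /frac_scale mulrDr. Qed.
Lemma frac_scaleDl k : {morph frac_scale^~ k : a b / a + b}.
Proof. by move=> a b; rewrite /frac_scale rmorphD mulrDl. Qed.

HB.instance Definition _ := GRing.Zmodule_isLmodule.Build A fracmod
  frac_scaleA frac_scale1 frac_scaleDr frac_scaleDl.

Definition frac_mul (k : K) (l : fracmod) : fracmod := (k * l : K).

Lemma frac_mul_linear k : linear (frac_mul k).
Proof. by move=> a l m; rewrite /frac_mul mulrDr mulrCA. Qed.

HB.instance Definition _ k :=
  GRing.isLinear.Build A fracmod fracmod *:%R (frac_mul k) (frac_mul_linear k).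

End FractionModule.

(* K (x)_A M as a vector space over K. *)
Section ScalarExtension.
Variables (A : idomainType) (M : lmodType A).
Local Notation K := {fraction A}.

Definition fracext := tensor (fracmod A) M.
HB.instance Definition _ := GRing.Zmodule.on fracext.

Definition ext_scale (k : K) : fracext -> fracext :=
  tensor_map (@frac_mul A k) (@idfun M).

Lemma ext_scaleE k a l m :
  ext_scale k (a *: tens l m) = a *: tens (frac_mul k l) m.
Proof. by rewrite /ext_scale linearZ /= tensor_mapE. Qed.

Lemma ext_scaleDr : right_distributive ext_scale +%R.
Proof. by move=> k t u; rewrite /ext_scale raddfD. Qed.

Lemma ext_scale0 k : ext_scale k 0 = 0.
Proof. by rewrite /ext_scale raddf0. Qed.

Lemma ext_scale_cons k a l m t : ext_scale k (a *: tens l m + t) =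
  a *: tens (frac_mul k l) m + ext_scale k t.
Proof. by rewrite ext_scaleDr ext_scaleE. Qed.

Lemma ext_scaleA k l t : ext_scale k (ext_scale l t) = ext_scale (k * l) t.
Proof.
elim/tensor_ind: t => [|a j m t IH].
  by rewrite (ext_scale0 l) (ext_scale0 k) (ext_scale0 (k * l)).
rewrite (ext_scale_cons l) (ext_scale_cons k) (ext_scale_cons (k * l)) IH.
by rewrite /frac_mul mulrA.
Qed.

Lemma ext_scale1 : left_id 1 ext_scale.
Proof.
elim/tensor_ind => [|a j m t IH]; first exact: ext_scale0.
by rewrite (ext_scale_cons 1) IH /frac_mul mul1r.
Qed.

Lemma ext_scaleDl t : {morph ext_scale^~ t : k l / k + l}.
Proof.
move=> k l; elim/tensor_ind: t => [|a j m t IH].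
  by rewrite (ext_scale0 (k + l)) (ext_scale0 k) (ext_scale0 l) addr0.
rewrite (ext_scale_cons (k + l)) (ext_scale_cons k) (ext_scale_cons l) IH.
have -> : frac_mul (k + l) j = frac_mul k j + frac_mul l j.
  by rewrite /frac_mul mulrDl.
by rewrite tensDl scalerDr; apply: addrACA.
Qed.

HB.instance Definition _ := GRing.Zmodule_isLmodule.Build K fracext
  ext_scaleA ext_scale1 ext_scaleDr ext_scaleDl.

(* The canonical map M -> K (x)_A M, through which M is viewed inside K (x)_A M
   when M is torsion-free. *)
Definition ext_inj (m : M) : fracext := tens (1 : fracmod A) m.

Lemma ext_injD : {morph ext_inj : m n / m + n}.
Proof. by move=> m n; rewrite /ext_inj tensDr. Qed.

Lemma ext_injZ a m : ext_inj (a *: m) = tofrac a *: ext_inj m.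
Proof.
rewrite /ext_inj tensZr -tensZl; symmetry.
exact: (tensor_mapE (@frac_mul A (tofrac a)) (@idfun M)).
Qed.

Definition Kline (x : M) : {pred M} :=
  fun m => `[< exists k : K, ext_inj m = k *: ext_inj x >].

Lemma Kline_submod_closed x : submod_closed (Kline x).
Proof.
split=> [|a u v /asboolP[k uk] /asboolP[l vl]]; apply/asboolP.
  by exists 0; rewrite -[0 in LHS](scale0r x) ext_injZ rmorph0.
by exists (tofrac a * k + l); rewrite ext_injD ext_injZ uk vl scalerDl scalerA.
Qed.

HB.instance Definition _ x :=
  GRing.isSubmodClosed.Build A M (Kline x)
    (GRing.submod_closed_semi (Kline_submod_closed x)).

(* K x \cap M, with its A-module structure. *)
Definition KxcapM (x : M) := {m : M | m \in Kline x}.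
HB.instance Definition _ x := SubChoice.on (KxcapM x).
HB.instance Definition _ x :=
  [SubChoice_isSubLmodule of KxcapM x by <:].

End ScalarExtension.

Definition has_dim (K : fieldType) (V : lmodType K) (n : nat) : Prop :=
  exists e : 'I_n -> V, forall v,
    exists! c : {ffun 'I_n -> K}, v = \sum_i c i *: e i.

Definition has_rank (A : idomainType) (M : lmodType A) (n : nat) : Prop :=
  has_dim (fracext M) n.

Section PreSchreier.
Variables (A : idomainType) (M : lmodType A).

Definition torsion_free : Prop :=
  forall (a : A) (x : M), a *: x = 0 -> a = 0 \/ x = 0.

Definition PS_module : Prop := torsion_free /\
  forall (a b : A) (x y : M), a != 0 -> b != 0 -> x != 0 -> y != 0 ->
    a *: x = b *: y ->
    exists (c d e : A) (z : M),
      [/\ a = c * e, b = c * d, x = d *: z & y = e *: z].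

Definition finitely_generated : Prop :=
  exists s : seq M, forall x, lspan (fun y => y \in s) x.

Definition locally_cyclic : Prop :=
  forall s : seq M, exists z : M, forall x,
    lspan (fun y => y \in s) x -> lspan (eq z) x.

End PreSchreier.

Definition PS_domain (A : idomainType) : Prop := PS_module A^o.

(* Main.v *)
Require Import Defs.
From HB Require Import structures.
From mathcomp Require Import all_boot all_order all_algebra.
From mathcomp Require Import boolp finmap.
From mathcomp.multinomials Require Import monalg.

(* In a torsion-free PS module two nonzero dependent elements, a x = b y with
   a, b != 0, are common multiples of the z of a refinement; hence a PS module
   whose elements are pairwise dependent is locally cyclic.

   A locally cyclic torsion-free module N behaves like a union of free modules
   of rank one: an equality z (x) p = 0 in N (x) P involves finitely many
   bilinearity relations, whose N-entries all lie in one line A w = A, and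
   reading the coefficient along w in these relations gives c p = 0 where
   z = c w.  This yields flatness, and also, applied to N = K (locally cyclic by
   common denominators), the injectivity of M -> K (x) M, which translates
   dependence over K in K (x) M into dependence over A in M.

   Finally a finitely generated locally cyclic module of rank one is isomorphic
   to A, so A inherits the refinement property from it. *)

Set Implicit Arguments.
Unset Strict Implicit.
Unset Printing Implicit Defensive.

Import GRing.Theory.

(** * Local cyclicity of PS modules and of the fraction field *)

Section LocallyCyclic.
Local Open Scope ring_scope.

Lemma lspan_eqP (A : nzRingType) (V : lmodType A) (z x : V) :
  lspan (eq z) x <-> exists a, x = a *: z.
Proof.
split=> [[s sz ->]|[a ->]].
  exists (\sum_(p <- s) p.1); rewrite scaler_suml.
  by rewrite [LHS]big_seq [RHS]big_seq; apply: eq_bigr => p /sz <-.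
by exists [:: (a, z)]; rewrite ?big_seq1 // => p; rewrite inE => /eqP ->.
Qed.

Lemma lspan_mem (A : nzRingType) (V : lmodType A) (S : V -> Prop) x :
  S x -> lspan S x.
Proof. by move/mem_lspanb/asboolP. Qed.

Lemma locally_cyclicP (A : idomainType) (M : lmodType A) :
  locally_cyclic M <->
  forall s : seq M, exists z, forall x, x \in s -> exists a, x = a *: z.
Proof.
split=> lc s; have [z sz] := lc s; exists z => x.
  by move=> xs; apply/lspan_eqP/sz/lspan_mem.
case=> t ts ->; apply/asboolP.
rewrite -[asbool _]/(_ \in lspanb (eq z)) big_seq.
by apply: rpred_sum => p /ts /sz /lspan_eqP zp; apply/rpredZ/asboolP.
Qed.

(** For torsion-free [M] this means rank at most one, expressed without [K]. *)
Definition pairwise_dependent (A : idomainType) (M : lmodType A) : Prop :=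
  forall x y : M, x != 0 -> exists a b, a != 0 /\ a *: y = b *: x.

Lemma PS_locally_cyclic (A : idomainType) (M : lmodType A) :
  PS_module M -> pairwise_dependent M -> locally_cyclic M.
Proof.
move=> [tf ps] dep; apply/locally_cyclicP.
elim=> [|x s [z sz]]; first by exists 0.
have [x0|x0] := eqVneq x 0.
  exists z => y; rewrite inE => /orP[/eqP ->|/sz //].
  by exists 0; rewrite scale0r.
have [z0|z0] := eqVneq z 0.
  exists x => y; rewrite inE => /orP[/eqP ->|/sz [a ->]].
    by exists 1; rewrite scale1r.
  by exists 0; rewrite z0 scaler0 scale0r.
have [a [b [a0 E]]] := dep x z x0.
have b0 : b != 0.
  apply: contraNneq z0 => b0; move: E; rewrite b0 scale0r.
  by case/tf=> [/eqP|/eqP //]; rewrite (negPf a0).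
(* All of [s] are multiples of [z]; the refinement makes [z] and [x] multiples of one [w]. *)
have [c [d [e [w [_ _ zw xw]]]]] := ps _ _ _ _ a0 b0 z0 x0 E.
exists w => y; rewrite inE => /orP[/eqP ->|/sz [r ->]]; first by exists e.
by exists (r * d); rewrite zw scalerA.
Qed.

Lemma fraction_denom (A : idomainType) (k : {fraction A}) :
  exists a b : A, b != 0 /\ tofrac b * k = tofrac a.
Proof.
have [r ->] : exists r : {ratio A}, k = (\pi_{fraction A} r)%qT.
  by exists (repr k); rewrite reprK.
exists \n_r, \d_r; split; first exact: denom_ratioP.
rewrite [tofrac \d_r]piE [tofrac \n_r]piE -[LHS]FracField.pi_mul.
apply/eqmodP; rewrite /= FracField.equivfE /FracField.mulf.
by rewrite !numden_Ratio ?mul1r ?oner_neq0 ?denom_ratioP // mulr1 mulrC.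
Qed.

Lemma fracmod_torsion_free (A : idomainType) : torsion_free (fracmod A).
Proof.
move=> a k /eqP; rewrite [a *: k]/(tofrac a * k) mulf_eq0 tofrac_eq0.
by case/orP=> /eqP; [left|right].
Qed.

Lemma fracmod_locally_cyclic (A : idomainType) : locally_cyclic (fracmod A).
Proof.
apply/locally_cyclicP=> s.
suff [d d0 ds] : exists2 d : A, d != 0 &
    forall k : {fraction A}, k \in s -> exists a, tofrac d * k = tofrac a.
  (* With [d] a common denominator of [s], every entry is an [A]-multiple of [1/d]. *)
  exists ((tofrac d)^-1 : {fraction A}) => k /ds [a E]; exists a.
  suff Ek : (k : {fraction A}) = tofrac a / tofrac d by exact: Ek.
  by rewrite -E mulrAC divff ?mul1r ?tofrac_eq0.
elim: s => [|k s [d d0 ds]]; first by exists 1; rewrite ?oner_neq0.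
have [a [b [b0 E]]] := fraction_denom k.
exists (b * d); first by rewrite mulf_neq0.
move=> l; rewrite inE => /orP[/eqP ->|/ds [c F]].
  by exists (d * a); rewrite mulrC rmorphM mulrA [k * _]mulrC E -rmorphM mulrC.
by exists (b * c); rewrite rmorphM -mulrA F -rmorphM.
Qed.

End LocallyCyclic.

(** * Tensors over a locally cyclic module *)

Section TensorLine.
Local Open Scope ring_scope.
Variables (A : idomainType) (M N : lmodType A).

(** Only the values on the line [A w] are fixed; [phi] need not be linear elsewhere. *)
Definition line_coord (w : M) (phi : M -> A) := forall a, phi (a *: w) = a.

Lemma line_coord_exists (w : M) :
  torsion_free M -> w != 0 -> exists phi, line_coord w phi.
Proof.
move=> tf w0; have /boolp.choice [phi phiP] (m : M) :
    exists b, (exists a, m = a *: w) -> m = b *: w.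
  have [[a ->]|nm] := pselect (exists a, m = a *: w); first by exists a.
  by exists 0 => /nm.
exists phi => a; apply/eqP; rewrite -subr_eq0; apply/eqP.
have /eqP : a *: w = phi (a *: w) *: w by apply: phiP; exists a.
rewrite eq_sym -subr_eq0 -scalerBl => /eqP /tf[] // /eqP.
by rewrite (negPf w0).
Qed.

(** Since [phi] is known to be linear only on [A w], relations in the first factor are killed once
    their [M]-entries lie there; [s] lists these entries. It is fixed before [w], so that [w] can be
    chosen to suit it. *)
Lemma tensor_rel_line (g : {malg A[(M * N)%type]}) : tensor_rel g ->
  exists s : seq M, forall w phi, line_coord w phi ->
    (forall m, m \in s -> exists a, m = a *: w) ->
    free_lift (fun m (n : N) => phi m *: n) g = 0.
Proof.
case=> [m m' n|m n n'|a m n|a m n].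
- exists [:: m; m'] => w phi phiw sw.
  have [[b mb] [c mc]] : (exists a, m = a *: w) /\ (exists a, m' = a *: w).
    by split; apply: sw; rewrite !inE eqxx ?orbT.
  rewrite linearB linearD /= !free_lift_gen mb mc -scalerDl !phiw.
  by rewrite -scalerDl subrr.
- exists [::] => w phi _ _.
  by rewrite linearB linearD /= !free_lift_gen scalerDr subrr.
- exists [:: m] => w phi phiw /(_ m (mem_head _ _)) [b ->].
  by rewrite linearB [X in _ - X]linearZ /= !free_lift_gen scalerA !phiw scalerA subrr.
- exists [::] => w phi _ _.
  by rewrite linearB [X in _ - X]linearZ /= !free_lift_gen !scalerA mulrC subrr.
Qed.

Lemma tensor_pi_eq0_line (g : {malg A[(M * N)%type]}) : tensor_pi g = 0 ->
  exists s : seq M, forall w phi, line_coord w phi ->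
    (forall m, m \in s -> exists a, m = a *: w) ->
    free_lift (fun m (n : N) => phi m *: n) g = 0.
Proof.
rewrite -(linear0 (@tensor_pi A M N)) => /qclassP.
rewrite subr0 => /asboolP[t tr ->] {g}.
elim: t tr => [|p t IH] tr.
  by exists [::] => *; rewrite big_nil linear0.
have [s sP] : exists s : seq M, forall w phi, line_coord w phi ->
    (forall m, m \in s -> exists a, m = a *: w) ->
    free_lift (fun m (n : N) => phi m *: n) (\sum_(p <- t) p.1 *: p.2) = 0.
  by apply: IH => q qt; apply: tr; rewrite inE qt orbT.
have [s' s'P] := tensor_rel_line (tr p (mem_head _ _)).
exists (s' ++ s) => w phi phiw sw.
rewrite big_cons linearP /= (s'P w phi) // ?(sP w phi) ?scaler0 ?addr0 //.
  by move=> m ms; apply: sw; rewrite mem_cat ms orbT.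
by move=> m ms; apply: sw; rewrite mem_cat ms.
Qed.

Lemma tens_eq0 (z : M) (p : N) : torsion_free M -> locally_cyclic M ->
  tens z p = 0 -> exists c w, z = c *: w /\ c *: p = 0.
Proof.
move=> tf /locally_cyclicP lc /tensor_pi_eq0_line [s sP].
have [z0|z0] := eqVneq z 0; first by exists 0, 0; rewrite !scale0r.
(* One line [A w] contains both [z] and the entries of all relations used. *)
have [w sw] := lc (z :: s); have [c zc] := sw z (mem_head _ _).
have w0 : w != 0 by apply: contraNneq z0 => w0; rewrite zc w0 scaler0.
have [phi phiw] := line_coord_exists tf w0.
(* As [c = phi z], the element [c p] is the lift evaluated at the generator [(z, p)]. *)
exists c, w; split=> //; rewrite -[X in X *: _]phiw -zc.
rewrite -(free_lift_gen (fun m (n : N) => phi m *: n)); apply: sP phiw _.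
by move=> m ms; apply: sw; rewrite inE ms orbT.
Qed.

(** Two pure tensors add up to a pure one: their left factors are multiples of one [w], and the
    coefficients move to the right. *)
Lemma locally_cyclic_tensor_pure (t : tensor M N) : locally_cyclic M ->
  exists z n, t = tens z n.
Proof.
move/locally_cyclicP=> lc; elim/tensor_ind: t => [|a m n t [z [n' ->]]].
  by exists 0, 0; rewrite -[0 in RHS](scale0r 0) tensZl scale0r.
have [w ws] := lc [:: m; z].
have [[b mb] [c zc]] : (exists a, m = a *: w) /\ (exists a, z = a *: w).
  by split; apply: ws; rewrite !inE eqxx ?orbT.
exists w, ((a * b) *: n + c *: n').
by rewrite mb zc tensDr !tensZr !tensZl scalerA.
Qed.

End TensorLine.

(** * Flatness of locally cyclic torsion-free modules *)

Section Flatness.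
Local Open Scope ring_scope.

Lemma locally_cyclic_flat (A : idomainType) (M : lmodType A) :
  torsion_free M -> locally_cyclic M -> flat M.
Proof.
move=> tf lc N P f f_inj; apply: raddf_inj => t.
have [z [n ->]] := locally_cyclic_tensor_pure t lc.
rewrite /= tensor_mapE /= => /(tens_eq0 tf lc) [c [w [-> cf]]].
have cn : c *: n = 0 by apply: f_inj; rewrite linear0 linearZ.
by rewrite tensZl -tensZr cn -(scale0r (0 : N)) tensZr scale0r.
Qed.

End Flatness.

(** * Dependence over [K], the modules [Kx] meet [M], and rank one *)

Section Rank.
Local Open Scope ring_scope.

Lemma scale_div_trans (F : fieldType) (V : lmodType F) (k l : F) (u v x : V) :
  k != 0 -> u = k *: x -> v = l *: x -> v = (l / k) *: u.
Proof. by move=> k0 -> ->; rewrite scalerA mulfVK. Qed.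

Variables (A : idomainType) (M : lmodType A).

Lemma ext_inj0 : ext_inj (0 : M) = 0.
Proof. by rewrite -(scale0r 0) ext_injZ rmorph0 scale0r. Qed.

Lemma ext_inj_inj : torsion_free M -> injective (@ext_inj A M).
Proof.
move=> tf x y E; apply/eqP; rewrite -subr_eq0; apply/eqP.
have : ext_inj (x - y) = 0.
  by rewrite ext_injD E -ext_injD subrr ext_inj0.
have tfK := @fracmod_torsion_free A.
(* Here [1 = c w] in [K] and [c (x - y) = 0], so [c = 0] would give [1 = 0]. *)
case/(tens_eq0 tfK (@fracmod_locally_cyclic A)) => c [w [Ew /tf[c0|//]]].
move/eqP: Ew; rewrite c0 scale0r => /eqP K0; suff : (1 : {fraction A}) == 0.
  by rewrite oner_eq0.
exact/eqP.
Qed.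

(* The type underlying [fracext M] carries both an A- and a K-module structure;
   the scaling lemmas below name [fracext M] to select the latter. *)
Lemma ext_inj_dependent (x y : M) (k : {fraction A}) : torsion_free M ->
  ext_inj y = k *: ext_inj x -> exists a b, a != 0 /\ a *: y = b *: x.
Proof.
move=> tf E; have [a [b [b0 F]]] := fraction_denom k.
exists b, a; split=> //; apply: (ext_inj_inj tf).
rewrite (ext_injZ b y) (ext_injZ a x) E -F.
exact: (@scalerA _ (fracext M)).
Qed.

Lemma KlineP (x y : M) :
  reflect (exists k, ext_inj y = k *: ext_inj x) (y \in Kline x).
Proof. exact: asboolP. Qed.

(** A refinement taken in [M] stays on the line, because [z] is [u / d] in the scalar extension. *)
Lemma KxcapM_PS (x : M) : PS_module M -> PS_module (KxcapM x).
Proof.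
move=> [tf ps]; split=> [a u /(congr1 val)|a b u v a0 b0 u0 v0 /(congr1 val)].
  by rewrite linearZ linear0 => /tf[->|u0]; [left|right; apply: val_inj].
rewrite !linearZ /= => /ps[] //.
move=> c [d [e [z [-> -> uz vz]]]].
have d0 : tofrac d != 0 :> {fraction A}.
  rewrite tofrac_eq0; apply: contraNneq u0 => d0.
  by apply/eqP/val_inj; rewrite /= uz d0 scale0r.
have zx : z \in Kline x.
  have /KlineP[k uk] := valP u; apply/KlineP; exists ((tofrac d)^-1 * k).
  rewrite -[RHS](@scalerA _ (fracext M)) -uk /= uz (ext_injZ d z).
  by rewrite (@scalerA _ (fracext M)) (mulVf d0) (@scale1r _ (fracext M)).
by exists c, d, e, (Sub z zx); split=> //; apply: val_inj; rewrite linearZ.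
Qed.

Lemma KxcapM_dependent (x : M) : torsion_free M -> pairwise_dependent (KxcapM x).
Proof.
move=> tf u v u0.
have /KlineP[k uk] := valP u; have /KlineP[l vl] := valP v.
have k0 : k != 0.
  apply: contraNneq u0 => k0; apply/eqP/val_inj/(ext_inj_inj tf).
  by rewrite uk k0 scale0r linear0 ext_inj0.
have [|a [b [a0 E]]] := @ext_inj_dependent (val u) (val v) (l / k) tf.
  exact: (scale_div_trans k0 uk vl).
by exists a, b; split=> //; apply: val_inj; rewrite !linearZ.
Qed.

(** The images of [M] span the extension over [K]: [k (x) m] is [k] times [1 (x) m]. *)
Lemma fracext_eq0 : (forall m : M, ext_inj m = 0) ->
  forall v : fracext M, v = 0.
Proof.
move=> M0 v; elim/tensor_ind: v => [//|a k m t ->]; rewrite addr0.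
have -> : tens k m = k *: ext_inj m.
  rewrite -[LHS](_ : tens (frac_mul k 1) m = _); last by rewrite /frac_mul mulr1.
  by rewrite -[LHS]scale1r -ext_scaleE scale1r.
by rewrite M0 !scaler0.
Qed.

Lemma rank1_basis : has_rank M 1 ->
  exists2 e : fracext M, e != 0 & forall v, exists k : {fraction A}, v = k *: e.
Proof.
case=> e eP; exists (e ord0); last first.
  by move=> v; have [c [-> _]] := eP v; exists (c ord0); rewrite big_ord1.
apply/eqP => e0; have [c [_ uc]] := eP 0.
(* If [e = 0], every [k] is a coordinate of the zero vector, so uniqueness forces [0 = 1]. *)
have cE (k : {fraction A}) : c ord0 = k.
  rewrite (uc [ffun=> k]) ?ffunE // big_ord1 e0.
  by rewrite (@scaler0 _ (fracext M)).
by have := oner_neq0 {fraction A}; rewrite -(cE 1) (cE 0) eqxx.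
Qed.

Lemma rank1_neq0 : has_rank M 1 -> exists m : M, m != 0.
Proof.
case/rank1_basis=> e /eqP e0 _.
apply/not_existsP => M0; case: e0; apply: fracext_eq0 => m.
by have /negP := M0 m; rewrite negbK => /eqP ->; rewrite ext_inj0.
Qed.

Lemma rank1_dependent :
  torsion_free M -> has_rank M 1 -> pairwise_dependent M.
Proof.
move=> tf /rank1_basis[e _ eP] x y x0.
have [k Ek] := eP (ext_inj x); have [l El] := eP (ext_inj y).
have k0 : k != 0.
  apply: contraNneq x0 => k0; apply/eqP/(ext_inj_inj tf).
  by rewrite Ek k0 (@scale0r _ (fracext M)) ext_inj0.
exact: ext_inj_dependent tf (scale_div_trans k0 Ek El).
Qed.

(** The map sending [a] to [a z] is an isomorphism from [A] to [M], along which refinements are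
    pulled back. *)
Lemma cyclic_PS_domain (z : M) : z != 0 -> (forall x, exists a, x = a *: z) ->
  PS_module M -> PS_domain A.
Proof.
move=> z0 Mz [tf ps]; split=> [a x|a b x y a0 b0 x0 y0 E].
  by move/eqP; rewrite mulf_eq0 => /orP[] /eqP; [left|right].
have zK : injective (fun a => a *: z).
  move=> u v /eqP; rewrite -subr_eq0 -scalerBl => /eqP/tf[/eqP|/eqP].
    by rewrite subr_eq0 => /eqP.
  by rewrite (negPf z0).
have nz u : u != 0 -> u *: z != 0.
  by apply: contraNneq => uz; apply/eqP/zK; rewrite /= uz scale0r.
have Ez : a *: (x *: z) = b *: (y *: z).
  by rewrite !scalerA; congr (_ *: _).
have [c [d [e [w [ac bc xw yw]]]]] := ps _ _ _ _ a0 b0 (nz _ x0) (nz _ y0) Ez.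
have [r wr] := Mz w; exists c, d, e, r; split=> //; apply: zK.
  by rewrite xw wr scalerA.
by rewrite yw wr scalerA.
Qed.

End Rank.

Theorem proposition2p10 (A : idomainType) (M : lmodType A) (hM : PS_module M) :
  (forall x : M, locally_cyclic (KxcapM x) /\ PS_module (KxcapM x)) /\
  (forall N : lmodType A, PS_module N -> has_rank N 1 ->
     locally_cyclic N /\ flat N) /\
  ((exists N : lmodType A,
      PS_module N /\ finitely_generated N /\ has_rank N 1) ->
   PS_domain A).
Proof.
have rank1_lc (N : lmodType A) :
    PS_module N -> has_rank N 1 -> locally_cyclic N.
  by move=> psN rN; apply: PS_locally_cyclic (rank1_dependent psN.1 rN).
split; [|split].
- move=> x; have psx := KxcapM_PS x hM; split=> //.
  exact: PS_locally_cyclic (KxcapM_dependent hM.1).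
- move=> N psN rN; have lcN := rank1_lc N psN rN.
  by split; [|apply: locally_cyclic_flat psN.1 lcN].
(* Applied to a generating list [s], local cyclicity gives a single generator [z] of [N]. *)
- case=> N [psN [[s sN] rN]]; have [z zs] := rank1_lc N psN rN s.
  have Nz x : exists a, x = (a *: z)%R by apply/lspan_eqP/zs.
  have [m m0] := rank1_neq0 rN.
  apply: (cyclic_PS_domain _ Nz psN); apply: contraNneq m0 => z0.
  by have [a ->] := Nz m; rewrite z0 scaler0.
Qed.
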